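(* If $H$ is a real $4\times 4$ Hadamard matrix in dephased form, then the possible sets of eigenvalues of $H$ (listed with multiplicity) are: $\{1,1,1,-1\}$, $\{1,1,-1,-1\}$ or $\{1,-1,e^{2\pi i/3},e^{4\pi i/3}\}$.
   Context: An $n\times n$ complex matrix $H$ is called a Hadamard matrix if it is unitary and all its entries have complex modulus $\frac{1}{\sqrt n}$. It is in dephased form if all entries of its first row and first column are equal to $\frac{1}{\sqrt n}$. Real means that all entries are real. *)

(* Defs.v *)
From mathcomp Require Import all_boot all_order all_algebra.
From mathcomp Require Import spectral complex.
From mathcomp Require Import reals trigo.

Set Implicit Arguments.
Unset Strict Implicit.
Unset Printing Implicit Defensive.

Import Order.TTheory GRing.Theory Num.Theory.
Local Open Scope ring_scope.
Local Open Scope complex_scope.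

Definition hadamardmx (C : numClosedFieldType) (n : nat) (H : 'M[C]_n) : Prop :=
  H \is unitarymx /\ forall i j, `|H i j| = 1 / sqrtC n%:R.

(* Indices are compared as naturals so that the definition covers every n,
   not only sizes of the form m.+1. *)
Definition dephased (C : numClosedFieldType) (n : nat) (H : 'M[C]_n) : Prop :=
  forall i j : 'I_n, val i = 0%N \/ val j = 0%N -> H i j = 1 / sqrtC n%:R.

(* s lists the eigenvalues of A with algebraic multiplicity; the order of s is
   irrelevant since the product is commutative. *)
Definition eigenvalues (F : fieldType) (n : nat) (A : 'M[F]_n) (s : seq F) :
  Prop := char_poly A = \prod_(a <- s) ('X - a%:P).

(* e^(i t) for real t *)
Definition expi (R : realType) (t : R) : R[i] := cos t +i* sin t.

(* Main.v *)
(** The entries of H are 1/2 or -1/2, and orthogonality to the first row leaves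
    exactly one 1/2 per row of the lower right 3x3 core, in pairwise distinct
    columns; so that core is P - J/2 for a permutation matrix P and the all-ones
    matrix J. The six determinants det (X - H) depend only on the number 3, 1
    or 0 of fixed points of P; in the last case the factor X^2 + X + 1 appears. *)

Require Import Defs.
From mathcomp Require Import all_boot all_order all_algebra.
From mathcomp Require Import spectral complex.
From mathcomp Require Import reals trigo.
From mathcomp Require Import ring lra.

Import Order.TTheory GRing.Theory Num.Theory.
Local Open Scope ring_scope.
Local Open Scope complex_scope.

(** Entries come from a function on naturals, so that after expansion every index is a numeral that
    computes. *)
Lemma det3 {R : comNzRingType} {A : 'M[R]_3} {f : nat -> nat -> R} :
    (forall i j, A i j = f i j) ->
  \det A = f 0 0 * (f 1 1 * f 2 2 - f 1 2 * f 2 1)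
         - f 0 1 * (f 1 0 * f 2 2 - f 1 2 * f 2 0)
         + f 0 2 * (f 1 0 * f 2 1 - f 1 1 * f 2 0).
Proof.
move=> Af; rewrite (expand_det_row _ ord0) !big_ord_recl big_ord0 /cofactor.
do 2 rewrite ?(expand_det_row _ ord0) ?big_ord_recl ?big_ord0 /cofactor.
by rewrite ?det_mx00 !mxE !Af /bump /= !(add0n, add1n) ?expr0 ?exprS; ring.
Qed.

(** Laplace expansion along the first two rows: each 2x2 minor of rows 0, 1 meets the complementary
    minor of rows 2, 3. *)
Lemma det4 {R : comNzRingType} {A : 'M[R]_4} {f : nat -> nat -> R} :
    (forall i j, A i j = f i j) ->
  let m2 i j k l := f i k * f j l - f i l * f j k in
  \det A =
    m2 0 1 0 1 * m2 2 3 2 3 - m2 0 1 0 2 * m2 2 3 1 3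
    + m2 0 1 0 3 * m2 2 3 1 2 + m2 0 1 1 2 * m2 2 3 0 3
    - m2 0 1 1 3 * m2 2 3 0 2 + m2 0 1 2 3 * m2 2 3 0 1.
Proof.
move=> Af m2; rewrite (expand_det_row _ ord0) !big_ord_recl big_ord0 /cofactor.
have minorE (k : 'I_4) i j : row' ord0 (col' k A) i j = f i.+1 (bump k j).
  by rewrite !mxE Af.
rewrite /= !(det3 (f := fun i j => f i.+1 (bump _ j)) (minorE _)) !Af.
by rewrite /m2 /bump /= !(add0n, add1n) ?expr0 ?exprS; ring.
Qed.

(** For a row [i] from 1 to 3, entry [i.-1] of [s] is the column of the [u] in the core, so [s] is
    the permutation in one-line notation on 1, 2, 3. The ring is arbitrary because the matrix is
    also needed over polynomials. *)
Definition dephased_signmx {R : pzRingType} (u : R) (s : seq nat) : 'M[R]_4 :=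
  \matrix_(i, j)
    (if [|| val i == 0, val j == 0 | val j == nth 0 s (val i).-1]%N
     then u else - u).

(* Homogeneous in x and u, so that for u = 1/2 the eigenvalues are read off
   without dividing in the polynomial ring. *)
Lemma det_dephased_signmx (R : comNzRingType) (x u : R) :
  let d (s : seq nat) := \det (x%:M - dephased_signmx u s) in
  [/\ d [:: 1; 2; 3]%N = (x - 2 * u) ^+ 3 * (x + 2 * u),
      {in [:: [:: 1; 3; 2]; [:: 2; 1; 3]; [:: 3; 2; 1]]%N,
        forall s, d s = (x - 2 * u) ^+ 2 * (x + 2 * u) ^+ 2}
    & {in [:: [:: 2; 3; 1]; [:: 3; 1; 2]]%N,
        forall s, d s = (x - 2 * u) * (x + 2 * u)
                        * (x ^+ 2 + 2 * u * x + (2 * u) ^+ 2)}].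
Proof.
pose f s (i j : nat) := x *+ (i == j)
  - (if [|| i == 0, j == 0 | j == nth 0 s i.-1]%N then u else - u).
have dE s (i j : 'I_4) : (x%:M - dephased_signmx u s) i j = f s i j.
  by rewrite !mxE.
split=> [|s|s]; rewrite ?inE.
- by rewrite (det4 (dE _)) /f /=; ring.
- by case/or3P=> /eqP->; rewrite (det4 (dE _)) /f /=; ring.
- by case/orP=> /eqP->; rewrite (det4 (dE _)) /f /=; ring.
Qed.

Lemma sum4 {R : nmodType} (F : 'I_4 -> R) :
  \sum_k F k = F (inord 0) + F (inord 1) + F (inord 2) + F (inord 3).
Proof.
rewrite !big_ord_recl big_ord0 addr0 !addrA.
by congr (F _ + F _ + F _ + F _); apply: val_inj; rewrite /= inordK.
Qed.

Lemma forall_ord4 (P : 'I_4 -> Prop) :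
  P (inord 0) -> P (inord 1) -> P (inord 2) -> P (inord 3) -> forall i, P i.
Proof.
move=> P0 P1 P2 P3 i; rewrite -(inord_val i).
by case: i => -[|[|[|[|//]]]].
Qed.

(** Ordered by cycle type: the identity, the three transpositions, the two 3-cycles. *)
Definition perms3 : seq (seq nat) :=
  [:: [:: 1; 2; 3]; [:: 1; 3; 2]; [:: 2; 1; 3]; [:: 3; 2; 1];
      [:: 2; 3; 1]; [:: 3; 1; 2]]%N.

(** Two distinct rows agree in exactly two of the four columns, so their products cancel. *)
Lemma gram_dephased_signmx {R : comNzRingType} (u : R) s (i j : 'I_4) :
    s \in perms3 ->
  \sum_k dephased_signmx u s i k * dephased_signmx u s j k
    = 4 * (u * u) *+ (i == j).
Proof.
move: i j; apply: forall_ord4; apply: forall_ord4;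
  rewrite sum4 !mxE -val_eqE /= !inordK //=;
  rewrite !inE => /or4P[||| /or3P[]] /eqP es; rewrite ?es {es} /=; ring.
Qed.

(** With [t] the angle, [2t] is [2 pi - t], so [cos t] is a root of [2c^2 - 1 = c], that is 1 or
    -1/2; strict decrease of cosine on [[0, pi]] excludes 1. *)
Lemma cos_2pi3 (R : realType) : cos (2 * pi / 3) = - 2^-1 :> R.
Proof.
set t : R := 2 * pi / 3.
have pi0 : 0 < (pi : R) := pi_gt0 R.
have c1 : cos t < 1.
  by rewrite -(cos0 R) ltr_cos ?in_itv /= /t; lra.
have dbl : cos (t *+ 2) = cos t.
  by rewrite -[t *+ 2](_ : - t + pi *+ 2 = _) ?cosD2pi ?cosN // /t; field.
have /eqP : (cos t - 1) * (2 * cos t + 1) = 0.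
  by move/eqP: dbl; rewrite cos_mulr2n -subr_eq0 => /eqP <-; ring.
rewrite mulf_eq0 subr_eq0 (lt_eqF c1) /= => /eqP; lra.
Qed.

(** The two angles add up to [2 pi], so the numbers are conjugate: their sum is [2 cos t] and their
    product [cos^2 t + sin^2 t]. *)
Lemma expi_cube_roots (R : realType) :
  let w1 : R[i] := expi (2 * pi / 3) in
  let w2 : R[i] := expi (4 * pi / 3) in
  w1 + w2 = -1 /\ w1 * w2 = 1.
Proof.
set t : R := 2 * pi / 3; rewrite /= /expi.
have -> : 4 * pi / 3 = - t + pi *+ 2 by rewrite /t; field.
rewrite cosD2pi sinD2pi cosN sinN -/t.
split; apply/eqP; rewrite eq_complex /=.
  by rewrite /t cos_2pi3 addrN oppr0 eqxx andbT; apply/eqP; field.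
rewrite mulrN opprK -!expr2 cos2Dsin2 eqxx /=.
by apply/eqP; ring.
Qed.

Section RealDephasedHadamard.
Variable C : numClosedFieldType.
Implicit Types (H : 'M[C]_4) (s : seq nat).

Let u : C := 2^-1.

Lemma inv_sqrtC4 : 1 / sqrtC 4%:R = u.
Proof. by rewrite -[4%:R](_ : 2 ^+ 2 = _) ?sqrCK ?div1r // -natrX. Qed.

(** Conjugation fixes real entries, so unitarity becomes orthonormality of the rows for the bilinear
    product. *)
Lemma real_unitary4P H : H \is a realmx ->
  reflect (forall i j, \sum_k H i k * H j k = (i == j)%:R)
          (H \is unitarymx).
Proof.
move=> /mxOverP Hr.
have HE : H *m (H ^t*)%sesqui = \matrix_(i, j) \sum_k H i k * H j k.
  apply/matrixP => i j; rewrite !mxE; apply: eq_bigr => k _.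
  by rewrite !mxE (CrealP (Hr _ _)).
apply: (iffP unitarymxP); rewrite HE.
  by move=> + i j => /matrixP/(_ i j); rewrite !mxE.
by move=> Hd; apply/matrixP=> i j; rewrite !mxE.
Qed.

Lemma sign_row_sum0 (x y z : C) :
    x \in [:: u; - u] -> y \in [:: u; - u] -> z \in [:: u; - u] ->
    u + x + y + z = 0 ->
  [\/ [/\ x = u, y = - u & z = - u], [/\ x = - u, y = u & z = - u]
    | [/\ x = - u, y = - u & z = u]].
Proof.
(* The five sign patterns to exclude have sum [4u], [2u] (three times) or [-2u], all nonzero in
   characteristic 0. *)
have nz k : u *+ k.+1 = 0 -> False.
  by move/eqP; rewrite mulrn_eq0 /= invr_eq0 pnatr_eq0.
rewrite !inE => /pred2P[]-> /pred2P[]-> /pred2P[]-> e;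
  try (by constructor); exfalso.
- by apply: (nz 3%N); rewrite -[RHS]e; ring.
- by apply: (nz 1%N); rewrite -[RHS]e; ring.
- by apply: (nz 1%N); rewrite -[RHS]e; ring.
- by apply: (nz 1%N); rewrite -[RHS]e; ring.
- by apply: (nz 1%N); apply: oppr_inj; rewrite oppr0 -[RHS]e; ring.
Qed.

Lemma dephased_row H (i : 'I_4) :
    hadamardmx H -> H \is a realmx -> dephased H -> val i != 0%N ->
  exists2 k : nat, k \in [:: 1; 2; 3]%N &
    forall j : 'I_4, H i j = if (val j == 0)%N || (val j == k) then u else - u.
Proof.
move=> [Hu Hn] Hr Hd i0.
have u_ge0 : 0 <= u by rewrite invr_ge0 ler0n.
have sgn j : H i j \in [:: u; - u].
  have /eqP := Hn i j; rewrite inv_sqrtC4 real_eqr_norml ?u_ge0 ?andbT ?inE //.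
  exact: (mxOverP Hr).
have Hi0 : H i (inord 0) = u.
  by rewrite Hd ?inv_sqrtC4 //; right; rewrite /= inordK.
have Hd0 j : H (inord 0) j = u.
  by rewrite Hd ?inv_sqrtC4 //; left; rewrite /= inordK.
have /eqP := (elimT (real_unitary4P _ Hr) Hu) i (inord 0).
rewrite (_ : (i == _) = false); last first.
  by apply: contraNF i0 => /eqP->; rewrite /= inordK.
(* Row 0 is constantly [u], so the inner product is [u] times the sum of row [i], and that sum
   vanishes. *)
rewrite sum4 !Hd0 Hi0 -!mulrDl mulf_eq0 [u == 0]invr_eq0 pnatr_eq0 orbF => /eqP.
case/(sign_row_sum0 _ _ _ (sgn _) (sgn _) (sgn _)) => -[h1 h2 h3].
- by exists 1%N => //; apply: forall_ord4; rewrite ?Hi0 ?h1 ?h2 ?h3 /= inordK.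
- by exists 2%N => //; apply: forall_ord4; rewrite ?Hi0 ?h1 ?h2 ?h3 /= inordK.
- by exists 3%N => //; apply: forall_ord4; rewrite ?Hi0 ?h1 ?h2 ?h3 /= inordK.
Qed.

Lemma real_dephased_hadamard4P H :
  [/\ hadamardmx H, H \is a realmx & dephased H] <->
  exists2 s, s \in perms3 & H = dephased_signmx u s.
Proof.
have u_real : u \is Num.real by rewrite rpredV realn.
split=> [[Hh Hr Hd]|[s Hs ->]].
  pose is_row n k := forall j : 'I_4,
    H (inord n) j = if (val j == 0)%N || (val j == k) then u else - u.
  have row n : (0 < n < 4)%N -> exists2 k, k \in [:: 1; 2; 3]%N & is_row n k.
    by move=> /andP[n0 n4]; apply: dephased_row; rewrite //= inordK // -lt0n.
  have [[a Ha Ea] [b Hb Eb] [c Hc Ec]] :=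
    And3 (row 1%N isT) (row 2%N isT) (row 3%N isT).
  (* Rows with the same [k] coincide, so their inner product would be both 1 and 0. *)
  have distinct m n k : (0 < m < n)%N -> (n < 4)%N -> ~ (is_row m k /\ is_row n k).
    move=> /andP[m0 mn] n4 [Em En].
    have orth := elimT (real_unitary4P _ Hr) Hh.1.
    have := orth (inord m) (inord n).
    rewrite (eq_bigr (fun k => H (inord m) k * H (inord m) k)); last first.
      by move=> j _; rewrite Em En.
    rewrite orth eqxx -val_eqE /= !inordK ?(ltn_eqF mn) //; last exact: ltn_trans n4.
    by move/eqP; rewrite oner_eq0.
  exists [:: a; b; c].
    have ab : a != b by apply/eqP => e; subst b; apply: (distinct 1%N 2%N a).
    have ac : a != c by apply/eqP => e; subst c; apply: (distinct 1%N 3%N a).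
    have bc : b != c by apply/eqP => e; subst c; apply: (distinct 2%N 3%N b).
    (* Of the 27 triples, the inequalities leave the six in [perms3]. *)
    move: Ha Hb Hc ab ac bc; rewrite !inE.
    by move=> /or3P[]/eqP-> /or3P[]/eqP-> /or3P[]/eqP->.
  apply/matrixP; apply: forall_ord4 => j; rewrite mxE ?Ea ?Eb ?Ec /= inordK //=.
  by rewrite Hd ?inv_sqrtC4 //; left; rewrite /= inordK.
have Hr : dephased_signmx u s \is a realmx.
  by apply/mxOverP => i j; rewrite mxE; case: ifP; rewrite ?rpredN.
have uu : 4 * (u * u) = 1 by rewrite /u; field.
split=> //.
- split.
    by apply/real_unitary4P => // i j; rewrite gram_dephased_signmx // uu.
  move=> i j; rewrite inv_sqrtC4 mxE; case: ifP => _; rewrite ?normrN;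
  by rewrite ger0_norm // invr_ge0 ler0n.
- by move=> i j; rewrite inv_sqrtC4 mxE => -[] -> /=; rewrite ?orbT.
Qed.

(** The determinant formulas are applied over [{poly C}] with [x] the indeterminate and [u] a
    constant polynomial, where [2u = 1]. *)
Lemma char_poly_dephased_signmx (w1 w2 : C) : w1 + w2 = -1 -> w1 * w2 = 1 ->
  [/\ eigenvalues (dephased_signmx u [:: 1; 2; 3]%N) [:: 1; 1; 1; -1],
      {in [:: [:: 1; 3; 2]; [:: 2; 1; 3]; [:: 3; 2; 1]]%N,
        forall s, eigenvalues (dephased_signmx u s) [:: 1; 1; -1; -1]}
    & {in [:: [:: 2; 3; 1]; [:: 3; 1; 2]]%N,
        forall s, eigenvalues (dephased_signmx u s) [:: 1; -1; w1; w2]}].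
Proof.
move=> wD wM.
have cpE s' : char_poly (dephased_signmx u s') =
    \det ('X%:M - dephased_signmx u%:P s').
  congr (\det _); apply/matrixP => i j; rewrite !mxE.
  by case: ifP; rewrite // polyCN.
have u2 : 2 * u%:P = 1 :> {poly C}.
  by rewrite mulr_natl -polyCMn -mulr_natl mulfV ?pnatr_eq0.
have [d1 d2 d3] := det_dephased_signmx _ 'X u%:P.
split=> [|t ts|t ts]; rewrite /eigenvalues !big_cons big_nil cpE.
- by rewrite d1 u2 polyCN; ring.
- by rewrite d2 // u2 polyCN; ring.
- rewrite d3 // u2 polyCN.
  (* Vieta: the sum and product of [w1] and [w2] are the only facts about them that enter. *)
  have -> : 'X ^+ 2 + 1 * 'X + 1 ^+ 2 = ('X - w1%:P) * ('X - w2%:P).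
    have wD' : w1%:P + w2%:P = -1 by rewrite -polyCD wD polyCN.
    have wM' : w1%:P * w2%:P = 1 by rewrite -polyCM wM.
    transitivity ('X ^+ 2 - (w1%:P + w2%:P) * 'X + w1%:P * w2%:P); last by ring.
    by rewrite wD' wM'; ring.
  by rewrite polyC1; ring.
Qed.

End RealDephasedHadamard.

Theorem corollary1 (R : realType) :
  let real_dephased_hadamard (H : 'M[R[i]]_4) :=
    [/\ hadamardmx H, H \is a realmx & dephased H] in
  let s1 : seq R[i] := [:: 1; 1; 1; -1] in
  let s2 : seq R[i] := [:: 1; 1; -1; -1] in
  let s3 : seq R[i] := [:: 1; -1; expi (2 * pi / 3); expi (4 * pi / 3)] in
  (forall H : 'M[R[i]]_4, real_dephased_hadamard H ->
     [\/ eigenvalues H s1, eigenvalues H s2 | eigenvalues H s3]) /\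
  [/\ exists2 H : 'M[R[i]]_4, real_dephased_hadamard H & eigenvalues H s1,
      exists2 H : 'M[R[i]]_4, real_dephased_hadamard H & eigenvalues H s2
    & exists2 H : 'M[R[i]]_4, real_dephased_hadamard H & eigenvalues H s3].
Proof.
move=> rdh s1 s2 s3.
have [wD wM] := expi_cube_roots R.
have [e1 e2 e3] := char_poly_dephased_signmx _ _ _ wD wM.
split=> [H /real_dephased_hadamard4P[s ss ->]|].
  (* Split [perms3] by cycle type, one block for each spectrum. *)
  move: ss; rewrite -[perms3]/([:: [:: 1; 2; 3]]
    ++ [:: [:: 1; 3; 2]; [:: 2; 1; 3]; [:: 3; 2; 1]]
    ++ [:: [:: 2; 3; 1]; [:: 3; 1; 2]])%N.
  rewrite !mem_cat mem_seq1 => /or3P[/eqP->|ss|ss].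
  - by constructor 1.
  - by constructor 2; apply: e2.
  - by constructor 3; apply: e3.
have rdhP s : s \in perms3 -> rdh (dephased_signmx 2^-1 s).
  by move=> ss; apply/real_dephased_hadamard4P; exists s.
(* One permutation of each cycle type realizes each spectrum. *)
split.
- by exists (dephased_signmx 2^-1 [:: 1; 2; 3]%N); [apply: rdhP|].
- by exists (dephased_signmx 2^-1 [:: 1; 3; 2]%N); [apply: rdhP|apply: e2].
- by exists (dephased_signmx 2^-1 [:: 2; 3; 1]%N); [apply: rdhP|apply: e3].
Qed.
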